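(* Let $A=(A,\ast_1,\circ_1)$ be a pre-Poisson algebra, $E$ a vector space containing $A$ as a subspace, and $V$ a complement of $A$ in $E$ (so $E=A\oplus V$). (1) Let $H^2_{p}(V,A)=\mathcal{A}(A,V)/\equiv$. The map $$\Phi: H^2_{p}(V,A)\longrightarrow Extd(E,A),\qquad \overline{\Omega(A,V)}\longmapsto \overline{A\natural V}$$ is a bijection, where $\overline{\Omega(A,V)}$ and $\overline{A\natural V}$ are the equivalence classes under $\equiv$ of $\Omega(A,V)$ and of $A\natural V$ respectively. (2) Let $H^2(V,A)=\mathcal{A}(A,V)/\approx$. The map $$\Psi: H^2(V,A)\longrightarrow Extd'(E,A),\qquad [\Omega(A,V)]\longmapsto [A\natural V]$$ is a bijection, where $[\Omega(A,V)]$ and $[A\natural V]$ are the cohomology classes under $\approx$ of $\Omega(A,V)$ and of $A\natural V$ respectively. Here the algebra $A\natural V$ on $A\oplus V$ is regarded as a pre-Poisson algebra structure on $E$ through the identification $(a,x)\leftrightarrow a+x$.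
   Context: All vector spaces and algebras are finite-dimensional over a field $k$. A Zinbiel algebra is a vector space $A$ with a bilinear map $\ast$ such that $x\ast(y\ast z)=(y\ast x)\ast z+(x\ast y)\ast z$. A pre-Lie algebra is a vector space with a bilinear map $\circ$ such that $x\circ(y\circ z)-(x\circ y)\circ z=y\circ(x\circ z)-(y\circ x)\circ z$. A pre-Poisson algebra is a triple $(A,\ast,\circ)$ with $(A,\ast)$ Zinbiel, $(A,\circ)$ pre-Lie, and $(x\circ y-y\circ x)\ast z=x\circ(y\ast z)-y\ast(x\circ z)$ and $(x\ast y+y\ast x)\circ z=x\ast(y\circ z)+y\ast(x\circ z)$ for all $x,y,z$. Homomorphisms are linear maps preserving both operations. A pre-Poisson extending datum of $(A,\ast_1,\circ_1)$ through $V$ is a tuple $\Omega(A,V)=(l_1,r_1,l_2,r_2,f,\ast_2,\rho_1,\mu_1,\rho_2,\mu_2,g,\circ_2)$ of linear maps $l_1,r_1,\rho_1,\mu_1:A\to \mathrm{End}(V)$, $l_2,r_2,\rho_2,\mu_2:V\to\mathrm{End}(A)$ and bilinear maps $f,g:V\times V\to A$, $\ast_2,\circ_2:V\times V\to V$. $A\natural V$ denotes $A\oplus V$ with $$(a,x)\ast(b,y)=(a\ast_1 b+l_2(x)b+r_2(y)a+f(x,y),\; x\ast_2 y+l_1(a)y+r_1(b)x),$$ $$(a,x)\circ(b,y)=(a\circ_1 b+\rho_2(x)b+\mu_2(y)a+g(x,y),\; x\circ_2 y+\rho_1(a)y+\mu_1(b)x).$$ $\Omega(A,V)$ is a pre-Poisson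 extending structure if $A\natural V$ is a pre-Poisson algebra (the unified product). $\mathcal{A}(A,V)$ is the set of all pre-Poisson extending structures of $A$ through $V$. Two elements $\Omega(A,V)$ and $\Omega'(A,V)=(l'_1,r'_1,l'_2,r'_2,f',\ast'_2,\rho'_1,\mu'_1,\rho'_2,\mu'_2,g',\circ'_2)$ of $\mathcal{A}(A,V)$ are equivalent, $\Omega\equiv\Omega'$, if there are linear maps $\zeta:V\to A$ and $\eta:V\to V$ with $\eta$ bijective such that for all $a\in A$, $x,y\in V$: $\eta(l_1(a)x)=l'_1(a)\eta(x)$, $\eta(r_1(a)x)=r'_1(a)\eta(x)$, $\zeta(l_1(a)x)=a\ast_1\zeta(x)-r_2(x)a+r'_2(\eta(x))a$, $\zeta(r_1(a)x)=\zeta(x)\ast_1 a-l_2(x)a+l'_2(\eta(x))a$, $\eta(x\ast_2 y)=\eta(x)\ast'_2\eta(y)+l'_1(\zeta(x))\eta(y)+r'_1(\zeta(y))\eta(x)$, $\zeta(x\ast_2 y)=\zeta(x)\ast_1\zeta(y)+l'_2(\eta(x))\zeta(y)+r'_2(\eta(y))\zeta(x)+f'(\eta(x),\eta(y))-f(x,y)$, $\eta(\rho_1(a)x)=\rho'_1(a)\eta(x)$, $\eta(\mu_1(a)x)=\mu'_1(a)\eta(x)$, $\zeta(\rho_1(a)x)=a\circ_1\zeta(x)-\mu_2(x)a+\mu'_2(\eta(x))a$, $\zeta(\mu_1(a)x)=\zeta(x)\circ_1 a-\rho_2(x)a+\rho'_2(\eta(x))a$, $\eta(x\circ_2 y)=\eta(x)\circ'_2\eta(y)+\rho'_1(\zeta(x))\eta(y)+\mu'_1(\zeta(y))\eta(x)$,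 $\zeta(x\circ_2 y)=\zeta(x)\circ_1\zeta(y)+\rho'_2(\eta(x))\zeta(y)+\mu'_2(\eta(y))\zeta(x)+g'(\eta(x),\eta(y))-g(x,y)$. They are cohomologous, $\Omega\approx\Omega'$, if such a pair exists with $\eta=\mathrm{id}_V$. On the set of pre-Poisson algebra structures on $E$ containing $A$ as a pre-Poisson subalgebra: two structures are equivalent ($\equiv$) if there is a pre-Poisson isomorphism $\phi$ between them with $\phi|_A=\mathrm{id}_A$; they are cohomologous ($\approx$) if moreover $\phi$ can be chosen to co-stabilize $V$, i.e. $\pi\circ\phi=\pi$, where $\pi:E=A\oplus V\to V$ is the canonical projection. $Extd(E,A)$ and $Extd'(E,A)$ denote the sets of equivalence classes under $\equiv$ and $\approx$ respectively. *)

(* Defs.v *)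
From HB Require Import structures.
From mathcomp Require Import all_boot all_order all_algebra.
From mathcomp Require Import boolp ring.

Set Implicit Arguments.
Unset Strict Implicit.
Unset Printing Implicit Defensive.

Import GRing.Theory VectorInternalTheory.
Local Open Scope ring_scope.
Local Open Scope quotient_scope.

(* Finite-dimensional vector spaces are [vectType]s, and a bilinear map       *)
(* [U x V -> W] is a linear map ['Hom(U, 'Hom(V, W))].                        *)

Section Bilinear.
Variables (k : fieldType) (U V W : vectType k).

(* [linfun] returns an unspecified linear map on a non-linear argument, so    *)
(* [bilfun f] is only meaningful for bilinear [f]; see [bilfunE].             *)
Definition bilfun (f : U -> V -> W) : 'Hom(U, 'Hom(V, W)) :=
  linfun (fun x => linfun (f x)).

Lemma bilfunE (f : U -> V -> W) :
  (forall x, linear (f x)) -> (forall y, linear (f^~ y)) ->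
  forall x y, bilfun f x y = f x y.
Proof.
move=> fl fr x y.
have linE (U' W' : vectType k) (g : U' -> W') : linear g -> linfun g =1 g.
  move=> gl u.
  pose gM := GRing.isLinear.Build k U' W' _ g gl.
  pose gL : {linear U' -> W'} := HB.pack g gM.
  exact: (lfunE gL).
have F_lin : linear (fun x => linfun (f x)).
  move=> a u v; apply/lfunP => z.
  by rewrite add_lfunE scale_lfunE !linE //; apply: fr.
by rewrite /bilfun (linE _ _ _ F_lin) linE.
Qed.

End Bilinear.

(* Reduces identities in a vector space to identities in [k].                 *)
Lemma coord_eq (k : fieldType) (U : vectType k) (u v : U) :
  (forall phi : {linear U -> k^o}, phi u = phi v) -> u = v.
Proof.
move=> h; apply: (can_inj v2rK); apply/rowP => i.
have fl : linear (fun w : U => v2r w 0 i : k^o).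
  by move=> c x y; rewrite linearP !mxE.
pose fM := GRing.isLinear.Build k U k^o _ _ fl.
pose f : {linear U -> k^o} := HB.pack (fun w : U => v2r w 0 i : k^o) fM.
exact: (h f).
Qed.

Section PrePoisson.
Variables (k : fieldType) (U : vectType k).
Implicit Types m zm pm : 'Hom(U, 'Hom(U, U)).

Definition zinbiel_axiom m :=
  forall x y z, m x (m y z) = m (m y x) z + m (m x y) z.

Definition prelie_axiom m :=
  forall x y z,
    m x (m y z) - m (m x y) z = m y (m x z) - m (m y x) z.

Definition prepoisson_axiom1 zm pm :=
  forall x y z,
    zm (pm x y - pm y x) z = pm x (zm y z) - zm y (pm x z).

Definition prepoisson_axiom2 zm pm :=
  forall x y z,
    pm (zm x y + zm y x) z = zm x (pm y z) + zm y (pm x z).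

Definition is_prepoisson zm pm :=
  [/\ zinbiel_axiom zm, prelie_axiom pm,
      prepoisson_axiom1 zm pm & prepoisson_axiom2 zm pm].

Record prepoisson := PrePoisson {
  zmul : 'Hom(U, 'Hom(U, U));
  pmul : 'Hom(U, 'Hom(U, U));
  prepoissonP : is_prepoisson zmul pmul
}.

End PrePoisson.

Definition prepoisson_hom (k : fieldType) (U W : vectType k)
    (P : prepoisson U) (Q : prepoisson W) (phi : 'Hom(U, W)) : Prop :=
  (forall x y, phi (zmul P x y) = zmul Q (phi x) (phi y)) /\
  (forall x y, phi (pmul P x y) = pmul Q (phi x) (phi y)).

Section OneOperation.
Variables (k : fieldType) (A V : vectType k).

(* The two halves of an extending datum have the same shape and enter         *)
(* the unified product and the equivalence relations through the same         *)
(* formulas, so both are instances of one record: (l1,r1,l2,r2,f,*_2) for     *)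
(* the Zinbiel operation, (rho1,mu1,rho2,mu2,g,o_2) for the pre-Lie one.      *)
Record op_datum := OpDatum {
  l1 : 'Hom(A, 'End(V));
  r1 : 'Hom(A, 'End(V));
  l2 : 'Hom(V, 'End(A));
  r2 : 'Hom(V, 'End(A));
  cc : 'Hom(V, 'Hom(V, A));
  mul2 : 'Hom(V, 'Hom(V, V))
}.

Variable m1 : 'Hom(A, 'Hom(A, A)).

Definition unified_fun (D : op_datum) (p q : A * V) : A * V :=
  let: (a, x) := p in let: (b, y) := q in
  (m1 a b + l2 D x b + r2 D y a + cc D x y,
   mul2 D x y + l1 D a y + r1 D b x).

Definition unified_op (D : op_datum) :
    'Hom((A * V)%type, 'Hom((A * V)%type, (A * V)%type)) :=
  bilfun (unified_fun D).

Record op_equiv_by (zeta : 'Hom(V, A)) (eta : 'End(V)) (D D' : op_datum) :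
    Prop := OpEquivBy {
  op_equiv_l1 : forall a x, eta (l1 D a x) = l1 D' a (eta x);
  op_equiv_r1 : forall a x, eta (r1 D a x) = r1 D' a (eta x);
  op_equiv_r2 : forall a x,
    zeta (l1 D a x) = m1 a (zeta x) - r2 D x a + r2 D' (eta x) a;
  op_equiv_l2 : forall a x,
    zeta (r1 D a x) = m1 (zeta x) a - l2 D x a + l2 D' (eta x) a;
  op_equiv_mul2 : forall x y,
    eta (mul2 D x y) = mul2 D' (eta x) (eta y)
      + l1 D' (zeta x) (eta y) + r1 D' (zeta y) (eta x);
  op_equiv_cc : forall x y,
    zeta (mul2 D x y) = m1 (zeta x) (zeta y)
      + l2 D' (eta x) (zeta y) + r2 D' (eta y) (zeta x)
      + cc D' (eta x) (eta y) - cc D x y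
}.


Ltac lexp := rewrite ?(linearD, linearZ, linearN, add_lfunE, scale_lfunE,
  opp_lfunE, linear0, zero_lfunE) /= ?zero_lfunE.

Lemma unified_opE D p q : unified_op D p q = unified_fun D p q.
Proof.
apply: bilfunE => [[a x]|[b y]] c [a1 x1] [a2 x2] /=;
  by congr pair; lexp; apply: coord_eq => phi; lexp; ring.
Qed.

Definition glue (zeta : 'Hom(V, A)) (eta : 'End(V)) (p : A * V) : A * V :=
  (p.1 + zeta p.2, eta p.2).

Lemma op_equiv_byP zeta eta D D' :
  op_equiv_by zeta eta D D' <->
  forall p q, glue zeta eta (unified_op D p q) =
              unified_op D' (glue zeta eta p) (glue zeta eta q).
Proof.
split=> [[el er ezl ezr em ec] [a x] [b y]|h].
  rewrite !unified_opE /glue /=; lexp; rewrite el er em ezl ezr ec.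
  by congr pair; apply: coord_eq => phi; lexp; ring.
have {}h p q := etrans (esym (congr1 (glue zeta eta) (unified_opE D p q)))
                       (etrans (h p q) (unified_opE D' _ _)).
have hl a x := h (a, 0) (0, x).
have hr a x := h (0, x) (a, 0).
have hm x y := h (0, x) (0, y).
rewrite /glue /= in hl hr hm.
split=> [a x|a x|a x|a x|x y|x y].
- by case: (hl a x); lexp; rewrite !(add0r, addr0).
- by case: (hr a x); lexp; rewrite !(add0r, addr0).
- case: (hl a x); lexp; rewrite !(add0r, addr0) => e _.
  by rewrite addrAC -e addrAC subrr add0r.
- case: (hr a x); lexp; rewrite !(add0r, addr0) => e _.
  by rewrite addrAC -e addrAC subrr add0r.
- by case: (hm x y); lexp; rewrite !(add0r, addr0).
- case: (hm x y); lexp; rewrite !(add0r, addr0) => e _.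
  by rewrite -e addrAC subrr add0r.
Qed.

Lemma op_equiv_by_refl D : op_equiv_by 0 \1%VF D D.
Proof.
have g1 p : glue 0 \1%VF p = p.
  by case: p => a x; rewrite /glue /= zero_lfunE id_lfunE addr0.
by apply/op_equiv_byP => p q; rewrite !g1.
Qed.

Lemma op_equiv_by_sym zeta (eta eta' : 'End(V)) D D' :
  cancel eta eta' -> cancel eta' eta ->
  op_equiv_by zeta eta D D' ->
  op_equiv_by (- (zeta \o eta')%VF) eta' D' D.
Proof.
move=> K K' /op_equiv_byP h; apply/op_equiv_byP => p q.
have gK : cancel (glue zeta eta) (glue (- (zeta \o eta')%VF) eta').
  by case=> a x; rewrite /glue /= opp_lfunE comp_lfunE /= !K addrK.
have gK' : cancel (glue (- (zeta \o eta')%VF) eta') (glue zeta eta).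
  by case=> a x; rewrite /glue /= opp_lfunE comp_lfunE /= K' subrK.
by rewrite -{1}[p]gK' -{1}[q]gK' -h gK.
Qed.

Lemma op_equiv_by_trans zeta eta zeta' eta' D D' D'' :
  op_equiv_by zeta eta D D' -> op_equiv_by zeta' eta' D' D'' ->
  op_equiv_by (zeta + (zeta' \o eta)%VF) (eta' \o eta)%VF D D''.
Proof.
move=> /op_equiv_byP h /op_equiv_byP h'; apply/op_equiv_byP => p q.
have gg r : glue (zeta + (zeta' \o eta)%VF) (eta' \o eta)%VF r =
            glue zeta' eta' (glue zeta eta r).
  by case: r => a x; rewrite /glue /= add_lfunE !comp_lfunE /= addrA.
by rewrite !gg h h'.
Qed.

End OneOperation.

Section Extending.
Variables (k : fieldType) (A V : vectType k) (PA : prepoisson A).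

Record ext_datum := ExtDatum {
  zdat : op_datum A V;
  pdat : op_datum A V
}.

Definition unified_zmul (D : ext_datum) := unified_op (zmul PA) (zdat D).
Definition unified_pmul (D : ext_datum) := unified_op (pmul PA) (pdat D).

Record ext_structure := ExtStructure {
  ext_dat :> ext_datum;
  ext_structureP : is_prepoisson (unified_zmul ext_dat) (unified_pmul ext_dat)
}.

Definition unified_product (W : ext_structure) : prepoisson (A * V)%type :=
  PrePoisson (ext_structureP W).

Definition ext_equiv_by zeta eta (W W' : ext_structure) : Prop :=
  op_equiv_by (zmul PA) zeta eta (zdat W) (zdat W') /\
  op_equiv_by (pmul PA) zeta eta (pdat W) (pdat W').

Definition ext_equiv (W W' : ext_structure) : Prop :=
  exists (zeta : 'Hom(V, A)) (eta : 'End(V)),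
    bijective eta /\ ext_equiv_by zeta eta W W'.

Definition ext_cohom (W W' : ext_structure) : Prop :=
  exists zeta : 'Hom(V, A), ext_equiv_by zeta \1%VF W W'.

HB.instance Definition _ := gen_eqMixin ext_structure.
HB.instance Definition _ := gen_choiceMixin ext_structure.

Lemma lfun_bij (eta : 'End(V)) : bijective eta ->
  exists eta' : 'End(V), cancel eta eta' /\ cancel eta' eta.
Proof.
move=> bij_eta; have ker0 : lker eta == 0%VS by apply/lker0P/bij_inj.
exists (eta^-1)%VF.
have K := lker0_lfunK ker0; split=> //.
by have [g gK Kg] := bij_eta; move=> x; rewrite -{1}[x]Kg K Kg.
Qed.

Definition ext_equivb (W W' : ext_structure) : bool := `[< ext_equiv W W' >].
Definition ext_cohomb (W W' : ext_structure) : bool := `[< ext_cohom W W' >].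

Lemma ext_equivb_refl : reflexive ext_equivb.
Proof.
move=> W; apply/asboolP; exists 0, \1%VF; split.
  by exists id => x; rewrite id_lfunE.
by split; apply: op_equiv_by_refl.
Qed.

Lemma ext_equivb_sym : symmetric ext_equivb.
Proof.
suff imp W W' : ext_equivb W W' -> ext_equivb W' W.
  by move=> W W'; apply/idP/idP; apply: imp.
move=> /asboolP[zeta [eta [/lfun_bij[eta' [K K']] [hz hp]]]]; apply/asboolP.
exists (- (zeta \o eta')%VF), eta'; split; first by exists eta.
by split; apply: op_equiv_by_sym.
Qed.

Lemma ext_equivb_trans : transitive ext_equivb.
Proof.
move=> W' W W'' /asboolP[zeta [eta [b [hz hp]]]].
move=> /asboolP[zeta' [eta' [b' [hz' hp']]]]; apply/asboolP.
exists (zeta + (zeta' \o eta)%VF), (eta' \o eta)%VF; split.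
  by apply: eq_bij (bij_comp b' b) _ _ => x; rewrite comp_lfunE.
by split; apply: op_equiv_by_trans; eassumption.
Qed.

Lemma ext_cohomb_refl : reflexive ext_cohomb.
Proof.
by move=> W; apply/asboolP; exists 0; split; apply: op_equiv_by_refl.
Qed.

Lemma ext_cohomb_sym : symmetric ext_cohomb.
Proof.
suff imp W W' : ext_cohomb W W' -> ext_cohomb W' W.
  by move=> W W'; apply/idP/idP; apply: imp.
move=> /asboolP[zeta [hz hp]]; apply/asboolP.
have K : cancel (\1%VF : 'End(V)) (\1%VF : 'End(V)).
  by move=> x; rewrite !id_lfunE.
by exists (- (zeta \o \1)%VF); split; apply: op_equiv_by_sym.
Qed.

Lemma ext_cohomb_trans : transitive ext_cohomb.
Proof.
move=> W' W W'' /asboolP[zeta [hz hp]] /asboolP[zeta' [hz' hp']].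
apply/asboolP; exists (zeta + (zeta' \o \1)%VF).
rewrite /ext_equiv_by -{2 4}[\1%VF](comp_lfun1l (\1%VF : 'End(V))).
by split; apply: op_equiv_by_trans; eassumption.
Qed.

Canonical ext_equiv_rel :=
  EquivRel ext_equivb ext_equivb_refl ext_equivb_sym ext_equivb_trans.
Canonical ext_cohom_rel :=
  EquivRel ext_cohomb ext_cohomb_refl ext_cohomb_sym ext_cohomb_trans.

Definition H2p := {eq_quot ext_equiv_rel}.
Definition H2 := {eq_quot ext_cohom_rel}.

End Extending.

Section Extd.
Variables (k : fieldType) (E : vectType k) (A V : {vspace E}).
Variable PA : prepoisson (subvs_of A).

Record over_structure := OverStructure {
  over_pp :> prepoisson E;
  over_zmul : forall a b, vsval (zmul PA a b) = zmul over_pp (vsval a) (vsval b);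
  over_pmul : forall a b, vsval (pmul PA a b) = pmul over_pp (vsval a) (vsval b)
}.

Definition over_iso (S S' : over_structure) (phi : 'End(E)) : Prop :=
  [/\ prepoisson_hom S S' phi, bijective phi &
      forall a, a \in A -> phi a = a].

Definition over_equiv (S S' : over_structure) : Prop :=
  exists phi : 'End(E), over_iso S S' phi.

(* [daddv_pi V A] is the projection of [E] onto [V] along [A].                *)
Definition over_cohom (S S' : over_structure) : Prop :=
  exists phi : 'End(E),
    over_iso S S' phi /\ (daddv_pi V A \o phi)%VF = daddv_pi V A.

HB.instance Definition _ := gen_eqMixin over_structure.
HB.instance Definition _ := gen_choiceMixin over_structure.

Definition over_equivb (S S' : over_structure) : bool := `[< over_equiv S S' >].
Definition over_cohomb (S S' : over_structure) : bool := `[< over_cohom S S' >].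

Lemma over_iso_refl S : over_iso S S \1%VF.
Proof.
split; last by move=> a _; rewrite id_lfunE.
  by split=> x y; rewrite !id_lfunE.
by exists id => x; rewrite id_lfunE.
Qed.

Lemma over_iso_sym S S' phi : over_iso S S' phi ->
  exists psi : 'End(E),
    [/\ cancel phi psi, cancel psi phi & over_iso S' S psi].
Proof.
move=> [[hz hp] /lfun_bij[psi [K K']] hA]; exists psi; split=> //; split.
- by split=> x y; apply: (can_inj K); rewrite ?hz ?hp !K'.
- by exists phi.
- by move=> a /hA {1}<-; rewrite K.
Qed.

Lemma over_iso_trans S S' S'' phi psi :
  over_iso S S' phi -> over_iso S' S'' psi -> over_iso S S'' (psi \o phi)%VF.
Proof.
move=> [[hz hp] b hA] [[hz' hp'] b' hA']; split.
- by split=> x y; rewrite !comp_lfunE /= ?hz ?hp ?hz' ?hp'.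
- by apply: eq_bij (bij_comp b' b) _ _ => x; rewrite comp_lfunE.
- by move=> a aA; rewrite comp_lfunE /= hA ?hA'.
Qed.

Lemma over_equivb_refl : reflexive over_equivb.
Proof. by move=> S; apply/asboolP; exists \1%VF; apply: over_iso_refl. Qed.

Lemma over_equivb_sym : symmetric over_equivb.
Proof.
suff imp S S' : over_equivb S S' -> over_equivb S' S.
  by move=> S S'; apply/idP/idP; apply: imp.
by move=> /asboolP[phi /over_iso_sym[psi [_ _ h]]]; apply/asboolP; exists psi.
Qed.

Lemma over_equivb_trans : transitive over_equivb.
Proof.
move=> S' S S'' /asboolP[phi h] /asboolP[psi h']; apply/asboolP.
by exists (psi \o phi)%VF; apply: over_iso_trans h h'.
Qed.

Lemma over_cohomb_refl : reflexive over_cohomb.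
Proof.
move=> S; apply/asboolP; exists \1%VF.
by rewrite comp_lfun1r; split=> //; apply: over_iso_refl.
Qed.

Lemma over_cohomb_sym : symmetric over_cohomb.
Proof.
suff imp S S' : over_cohomb S S' -> over_cohomb S' S.
  by move=> S S'; apply/idP/idP; apply: imp.
move=> /asboolP[phi [/over_iso_sym[psi [K K' h]] e]]; apply/asboolP.
exists psi; split=> //; rewrite -{1}e -comp_lfunA.
suff -> : (phi \o psi)%VF = \1%VF by rewrite comp_lfun1r.
by apply/lfunP => x; rewrite comp_lfunE /= K' id_lfunE.
Qed.

Lemma over_cohomb_trans : transitive over_cohomb.
Proof.
move=> S' S S'' /asboolP[phi [h e]] /asboolP[psi [h' e']]; apply/asboolP.
exists (psi \o phi)%VF; split; first exact: over_iso_trans h h'.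
by rewrite comp_lfunA e'.
Qed.

Canonical over_equiv_rel :=
  EquivRel over_equivb over_equivb_refl over_equivb_sym over_equivb_trans.
Canonical over_cohom_rel :=
  EquivRel over_cohomb over_cohomb_refl over_cohomb_sym over_cohomb_trans.

Definition Extd := {eq_quot over_equiv_rel}.
Definition Extd' := {eq_quot over_cohom_rel}.

Definition is_complement : Prop := (A + V = fullv /\ A :&: V = 0)%VS.

(* The identification (a, x) <-> a + x of A (+) V with E, and its inverse.    *)
Definition dsum_val (p : subvs_of A * subvs_of V) : E := vsval p.1 + vsval p.2.
Definition dsum_split (e : E) : subvs_of A * subvs_of V :=
  (vsproj A (daddv_pi A V e), vsproj V (daddv_pi V A e)).

Definition transport
    (m : 'Hom((subvs_of A * subvs_of V)%type,
              'Hom((subvs_of A * subvs_of V)%type,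
                   (subvs_of A * subvs_of V)%type))) :
    'Hom(E, 'Hom(E, E)) :=
  bilfun (fun u v => dsum_val (m (dsum_split u) (dsum_split v))).

Lemma dsum_val_linear : linear dsum_val.
Proof.
by move=> c [a x] [b y]; rewrite /dsum_val /= scalerDr addrACA.
Qed.

Lemma dsum_split_linear : linear dsum_split.
Proof. by move=> c u v; rewrite /dsum_split !linearP. Qed.

HB.instance Definition _ := GRing.isLinear.Build k
  (subvs_of A * subvs_of V)%type E _ dsum_val dsum_val_linear.
HB.instance Definition _ := GRing.isLinear.Build k
  E (subvs_of A * subvs_of V)%type _ dsum_split dsum_split_linear.

Lemma transportE m u v : transport m u v = dsum_val (m (dsum_split u) (dsum_split v)).
Proof.
rewrite /transport bilfunE // => [x|y] c w w'.
  by rewrite !linearP.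
by rewrite !linearP /= add_lfunE scale_lfunE linearP.
Qed.

Hypothesis AV : is_complement.

Lemma dsum_splitK : cancel dsum_split dsum_val.
Proof.
case: AV => full dir e; rewrite /dsum_val /dsum_split /= !vsprojK ?memv_pi //.
by rewrite daddv_pi_add // full memvf.
Qed.

Lemma dsum_valK : cancel dsum_val dsum_split.
Proof.
case: AV => full dir [a x]; rewrite /dsum_val /dsum_split /= !linearD /=.
have dir' : (V :&: A = 0)%VS by rewrite capvC.
have pi0 (B C : {vspace E}) w : (B :&: C = 0)%VS -> w \in C -> daddv_pi B C w = 0.
  move=> BC wC; have CB : (C :&: B = 0)%VS by rewrite capvC.
  have := daddv_pi_add BC (subvP (addvSr B C) w wC).
  by rewrite (daddv_pi_id CB wC) => /(canRL (addrK _)); rewrite subrr.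
rewrite (pi0 A V (vsval x)) ?subvsP // (pi0 V A (vsval a)) ?subvsP //.
by rewrite !daddv_pi_id ?subvsP // !vsvalK ?linear0 addr0 add0r.
Qed.

Lemma transport_prepoisson z p :
  is_prepoisson z p -> is_prepoisson (transport z) (transport p).
Proof.
have splitB u v : dsum_split (u - v) = dsum_split u - dsum_split v by exact: linearB.
have splitD u v : dsum_split (u + v) = dsum_split u + dsum_split v by exact: linearD.
case=> hz hp h1 h2; split=> [x y w|x y w|x y w|x y w].
- by rewrite !transportE !dsum_valK hz linearD.
- by rewrite !transportE !dsum_valK -!linearB /= hp.
- rewrite (transportE z (_ - _)) !transportE splitB !dsum_valK h1.
  exact: linearB.
- rewrite (transportE p (_ + _)) !transportE splitD !dsum_valK h2.
  exact: linearD.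
Qed.

Definition unified_on_pp (W : ext_structure (subvs_of V) PA) : prepoisson E :=
  PrePoisson (transport_prepoisson (prepoissonP (unified_product W))).

Lemma dsum_split_val a : dsum_split (vsval a) = (a, 0).
Proof. by rewrite -[RHS]dsum_valK /dsum_val /= addr0. Qed.

Lemma unified_on_zmul W a b :
  vsval (zmul PA a b) = zmul (unified_on_pp W) (vsval a) (vsval b).
Proof.
rewrite /= transportE !dsum_split_val /unified_zmul unified_opE /=.
by rewrite /dsum_val /= ?(linear0, zero_lfunE, addr0).
Qed.

Lemma unified_on_pmul W a b :
  vsval (pmul PA a b) = pmul (unified_on_pp W) (vsval a) (vsval b).
Proof.
rewrite /= transportE !dsum_split_val /unified_pmul unified_opE /=.
by rewrite /dsum_val /= ?(linear0, zero_lfunE, addr0).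
Qed.

Definition unified_on (W : ext_structure (subvs_of V) PA) : over_structure :=
  OverStructure (unified_on_zmul W) (unified_on_pmul W).

Lemma unified_on_hom W :
  prepoisson_hom (unified_product W) (unified_on W) (linfun dsum_val).
Proof. by split=> p q; rewrite !lfunE /= transportE !dsum_valK. Qed.

End Extd.

(* Main.v *)
Require Import Defs.
From HB Require Import structures.
From mathcomp Require Import all_boot all_order all_algebra.
From mathcomp Require Import boolp.

Set Implicit Arguments.
Unset Strict Implicit.
Unset Printing Implicit Defensive.

Import GRing.Theory.
Local Open Scope ring_scope.
Local Open Scope quotient_scope.

(** Both parts reduce to two facts about the assignment of the product
    [A \natural V], transported to [E], to an extending structure.

    It preserves and reflects the equivalences.  A linear endomorphism [phi]
    of [E = A + V] that fixes [A] pointwise is determined by what it does on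
    [V], that is, by the two components [zeta : V -> A] and [eta : V -> V] of
    its restriction to [V]: in coordinates it is the triangular map
    [(a, x) |-> (a + zeta x, eta x)] ([fix_glue_on]).  It is bijective exactly
    when its diagonal block [eta] is, and it co-stabilizes [V] exactly when
    [eta] is the identity ([costabilize_glue_on]).  Multiplicativity of this
    map between two unified products, evaluated on pairs of vectors from the
    summands, is the list of identities that defines the equivalence of the
    two extending structures; so isomorphisms of products that fix [A]
    and witnesses [(zeta, eta)] are the same thing ([over_iso_glue_on]).

    It is surjective, already up to the identity isomorphism.  Given a
    structure on [E] that contains [A] as a subalgebra, split each product of
    two vectors taken from the summands [A] and [V] into its components.  They
    form an extending datum whose unified product is the given one, because a
    bilinear map on a direct sum is the sum of its four restrictions
    ([unified_on_surj]).  The axioms hold for the datum since they hold on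
    [E].

    The bijections of the quotients then follow formally
    ([quot_bijection]). *)

(** A map that preserves and reflects equivalence and meets every class induces
    a bijection of quotients; the inverse picks a preimage of a representative
    by choice. *)
Lemma quot_bijection (T U : choiceType) (e : equiv_rel T) (e' : equiv_rel U)
    (f : T -> U) :
  (forall x y, e x y = e' (f x) (f y)) ->
  (forall u, exists x, e' (f x) u) ->
  exists F : {eq_quot e} -> {eq_quot e'},
    (forall x, F (\pi_({eq_quot e}) x) = \pi_({eq_quot e'}) (f x)) /\
    bijective F.
Proof.
move=> ef surj.
pose F (q : {eq_quot e}) := \pi_({eq_quot e'}) (f (repr q)).
pose G (q : {eq_quot e'}) :=
  \pi_({eq_quot e}) (sval (cid (surj (repr q)))).
have Fpi x : F (\pi_({eq_quot e}) x) = \pi_({eq_quot e'}) (f x).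
  by apply/eqmodP; rewrite -ef; apply/eqmodP; rewrite reprK.
have GK : cancel G F.
  move=> q; rewrite /G Fpi -[RHS]reprK.
  by apply/eqmodP; case: cid.
exists F; split=> //; exists G => // q.
rewrite -[q]reprK; move: (repr q) => x; rewrite Fpi /G.
apply/eqmodP; rewrite ef; apply/eqmodP.
by case: cid => y /= /eqmodP ->; rewrite reprK.
Qed.

Lemma is_prepoisson_inj (k : fieldType) (U W : vectType k)
    (f : {linear U -> W}) (Q : prepoisson W) (zm pm : 'Hom(U, 'Hom(U, U))) :
  injective f ->
  (forall x y, f (zm x y) = zmul Q (f x) (f y)) ->
  (forall x y, f (pm x y) = pmul Q (f x) (f y)) ->
  is_prepoisson zm pm.
Proof.
move=> inj fz fp; case: (prepoissonP Q) => hz hp h1 h2.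
split=> x y z; apply: inj.
- by rewrite linearD !fz hz.
- by rewrite !linearB !fp hp.
- by rewrite fz (linearB f) !fp h1 (linearB f) !(fz, fp).
- by rewrite fp (linearD f) !fz h2 (linearD f) !(fz, fp).
Qed.

Section Glue.
Variables (k : fieldType) (A V : vectType k).

Lemma glue_linear (zeta : 'Hom(V, A)) (eta : 'End(V)) : linear (glue zeta eta).
Proof.
move=> c [a x] [b y]; rewrite /glue /= !linearP.
by congr pair; rewrite /= scalerDr addrACA.
Qed.

HB.instance Definition _ (zeta : 'Hom(V, A)) (eta : 'End(V)) :=
  GRing.isLinear.Build k (A * V)%type (A * V)%type _
    (glue zeta eta) (glue_linear zeta eta).

(** The matrix of [glue zeta eta] is block triangular with diagonal blocks the
    identity and [eta]. *)
Lemma glue_bij (zeta : 'Hom(V, A)) (eta : 'End(V)) :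
  bijective (glue zeta eta) <-> bijective eta.
Proof.
split=> [[g gK Kg]|[h hK Kh]].
  (* [(- zeta x, x)] is the preimage of [(0, eta x)]. *)
  exists (fun y => (g (0, y)).2) => [x|y].
    rewrite -{2}[x]/((- zeta x, x).2) -[RHS](congr1 snd (gK _)).
    by rewrite /glue /= addNr.
  by have := congr1 snd (Kg (0, y)).
exists (fun p => (p.1 - zeta (h p.2), h p.2)) => [[a x]|[a x]].
  by rewrite /glue /= hK addrK.
by rewrite /glue /= Kh subrK.
Qed.


Variable m1 : 'Hom(A, 'Hom(A, A)).
Variable m : 'Hom((A * V)%type, 'Hom((A * V)%type, (A * V)%type)).

(** Products of two elements of [A] are left out: the unified product takes
    them from the multiplication of [A]. *)
Definition op_datum_of : op_datum A V := OpDatum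
  (bilfun (fun a y => (m (a, 0) (0, y)).2))
  (bilfun (fun a x => (m (0, x) (a, 0)).2))
  (bilfun (fun x a => (m (0, x) (a, 0)).1))
  (bilfun (fun y a => (m (a, 0) (0, y)).1))
  (bilfun (fun x y => (m (0, x) (0, y)).1))
  (bilfun (fun x y => (m (0, x) (0, y)).2)).



(** A bilinear map on a direct sum is the sum of its restrictions to pairs of
    summands, so the datum read off from [m] gives back [m] as soon as the
    restriction to [A] is [m1]. *)
Lemma unified_op_datum_of :
  (forall a b, m (a, 0) (b, 0) = (m1 a b, 0)) ->
  forall p q, unified_op m1 op_datum_of p q = m p q.
Proof.
move=> m1E [a x] [b y].
have inlP c (a1 a2 : A) : ((c *: a1 + a2, 0) : A * V) = c *: (a1, 0) + (a2, 0).
  by congr pair; rewrite /= scaler0 addr0.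
have inrP c (x1 x2 : V) : ((0, c *: x1 + x2) : A * V) = c *: (0, x1) + (0, x2).
  by congr pair; rewrite /= scaler0 addr0.
have mlP c p p' q : m (c *: p + p') q = c *: m p q + m p' q.
  by rewrite linearP add_lfunE scale_lfunE.
have mD p p' q q' : m (p + p') (q + q') = m p q + m p q' + (m p' q + m p' q').
  by rewrite -[p]scale1r mlP !scale1r !linearD.
have pairD (c : A) (z : V) : (c, z) = (c, 0) + (0, z).
  by congr pair; rewrite /= ?addr0 ?add0r.
rewrite unified_opE /= !bilfunE;
  try by move=> ? c u v /=; rewrite ?inlP ?inrP ?mlP ?linearP.
rewrite (pairD a x) (pairD b y) mD m1E; congr pair => /=.
  by rewrite -!addrA; congr (_ + _); rewrite addrCA.
by rewrite add0r -addrA addrC -addrA.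
Qed.

End Glue.

Section Correspondence.
Variables (k : fieldType) (E : vectType k) (A V : {vspace E}).
Variables (PA : prepoisson (subvs_of A)) (AV : is_complement A V).

Let As := subvs_of A.
Let Vs := subvs_of V.

(** [glue zeta eta] seen on [E] through the identification of [(a, x)] with
    [a + x]. *)
Definition glue_on (zeta : 'Hom(Vs, As)) (eta : 'End(Vs)) : 'End(E) :=
  linfun (@dsum_val _ _ A V \o glue zeta eta \o @dsum_split _ _ A V).

Lemma glue_onE zeta eta p :
  glue_on zeta eta (dsum_val p) = dsum_val (glue zeta eta p).
Proof. by rewrite lfunE /= dsum_valK. Qed.

Lemma glue_on_bij zeta eta : bijective (glue_on zeta eta) <-> bijective eta.
Proof.
have sK := dsum_splitK AV; have vK := dsum_valK AV.
rewrite -(glue_bij zeta eta); split=> b.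
  have b' := bij_comp (Bijective sK vK) (bij_comp b (Bijective vK sK)).
  by apply: eq_bij b' _ _ => p /=; rewrite glue_onE vK.
have b' := bij_comp (Bijective vK sK) (bij_comp b (Bijective sK vK)).
by apply: eq_bij b' _ _ => e /=; rewrite lfunE.
Qed.

(** The components [zeta] and [eta] are those of the restriction of [phi] to
    [V]; on [A] there is nothing to choose. *)
Lemma fix_glue_on (phi : 'End(E)) :
  (forall a, a \in A -> phi a = a) -> exists zeta eta, phi = glue_on zeta eta.
Proof.
move=> phiA.
exists (linfun (fst \o @dsum_split _ _ A V \o phi \o vsval)).
exists (linfun (snd \o @dsum_split _ _ A V \o phi \o vsval)).
apply/lfunP => e; rewrite -[e](dsum_splitK AV); case: (dsum_split A V e) => a x.
rewrite glue_onE; apply: (can_inj (dsum_splitK AV)); rewrite dsum_valK //.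
rewrite /glue /dsum_val /= !lfunE /= linearD /= phiA ?subvsP // linearD /=.
by rewrite (dsum_split_val AV); congr pair; rewrite /= add0r.
Qed.

Lemma transport_homP
    (z z' : 'Hom((As * Vs)%type, 'Hom((As * Vs)%type, (As * Vs)%type)))
    (phi : E -> E) (psi : As * Vs -> As * Vs) :
  (forall p, phi (dsum_val p) = dsum_val (psi p)) ->
  (forall u v, phi (transport z u v) = transport z' (phi u) (phi v)) <->
  (forall p q, psi (z p q) = z' (psi p) (psi q)).
Proof.
move=> phiE; split=> h p q.
  apply: (can_inj (dsum_valK AV)).
  have := h (dsum_val p) (dsum_val q).
  by rewrite !transportE !phiE !dsum_valK.
rewrite -[p](dsum_splitK AV) -[q](dsum_splitK AV).
by rewrite !phiE !transportE !dsum_valK // phiE h.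
Qed.

(** Carried over to [A (+) V], multiplicativity of [glue_on zeta eta] becomes
    that of [glue zeta eta] between the two unified products, which
    [op_equiv_byP] expands into the defining identities of the equivalence. *)
Lemma over_iso_glue_on (W W' : ext_structure Vs PA) zeta eta :
  over_iso (unified_on AV W) (unified_on AV W') (glue_on zeta eta) <->
  bijective eta /\ ext_equiv_by zeta eta W W'.
Proof.
have conj z z' := transport_homP z z' (glue_onE zeta eta).
have fixA a : a \in A -> glue_on zeta eta a = a.
  move=> aA; rewrite -(vsprojK aA) lfunE /= (dsum_split_val AV).
  by rewrite /glue /dsum_val /= !linear0 /= !addr0.
split=> [[[hz hp] /glue_on_bij b _]|[b [/op_equiv_byP hz /op_equiv_byP hp]]].
  by split=> //; split; apply/op_equiv_byP/conj.
by split=> //; [split; apply/conj | apply/glue_on_bij].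
Qed.

Lemma costabilize_glue_on zeta eta :
  (daddv_pi V A \o glue_on zeta eta)%VF = daddv_pi V A <-> eta = \1%VF.
Proof.
have piE (p : As * Vs) : daddv_pi V A (dsum_val p) = vsval p.2.
  by rewrite -[in RHS](dsum_valK AV p) /= vsprojK ?memv_pi.
split=> [e|->]; apply/lfunP => x.
  apply: val_inj; have /lfunP/(_ (dsum_val ((0, x) : As * Vs))) := e.
  by rewrite comp_lfunE /= glue_onE !piE id_lfunE.
by rewrite comp_lfunE /= -[x](dsum_splitK AV) glue_onE !piE /glue /= id_lfunE.
Qed.

Definition pullback_op (M : 'Hom(E, 'End(E))) :
    'Hom((As * Vs)%type, 'Hom((As * Vs)%type, (As * Vs)%type)) :=
  bilfun (fun p q => dsum_split A V (M (dsum_val p) (dsum_val q))).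

Lemma pullback_opE M p q :
  dsum_val (pullback_op M p q) = M (dsum_val p) (dsum_val q).
Proof.
rewrite /pullback_op bilfunE ?dsum_splitK // => p' c u v.
  by rewrite !linearP.
by rewrite !linearP /= add_lfunE scale_lfunE linearP.
Qed.

(** The components of the two products of [S] form an extending structure whose
    unified product is [S] itself, so the identity of [E] is the required
    isomorphism, and it co-stabilizes [V]. *)
Lemma unified_on_surj (S : over_structure PA) :
  exists W : ext_structure Vs PA, over_cohom V (unified_on AV W) S.
Proof.
have unifiedE (m1 : 'Hom(As, 'End(As))) (M : 'Hom(E, 'End(E))) :
    (forall a b, vsval (m1 a b) = M (vsval a) (vsval b)) ->
    forall p q, dsum_val (unified_op m1 (op_datum_of (pullback_op M)) p q) =
                M (dsum_val p) (dsum_val q).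
  move=> m1E p q; rewrite unified_op_datum_of ?pullback_opE // => a b.
  apply: (can_inj (dsum_valK AV)); rewrite pullback_opE.
  by rewrite /dsum_val /= ?linear0 !addr0 m1E.
have zE := unifiedE _ _ (over_zmul S); have pE := unifiedE _ _ (over_pmul S).
pose D := ExtDatum (op_datum_of (pullback_op (zmul S)))
                   (op_datum_of (pullback_op (pmul S))).
have DP := is_prepoisson_inj (can_inj (dsum_valK AV)) zE pE.
exists (@ExtStructure _ _ _ PA D DP), \1%VF.
split; last by rewrite comp_lfun1r.
split=> [|| a _]; last by rewrite id_lfunE.
  split=> u v; rewrite !id_lfunE /= transportE.
    by rewrite /unified_zmul zE !dsum_splitK.
  by rewrite /unified_pmul pE !dsum_splitK.
by exists id => x; rewrite id_lfunE.
Qed.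

End Correspondence.

Theorem theorem2p24 (k : fieldType) (E : vectType k) (A V : {vspace E})
    (PA : prepoisson (subvs_of A)) (AV : is_complement A V) :
  (exists Phi : H2p (subvs_of V) PA -> Extd PA,
     (forall W : ext_structure (subvs_of V) PA,
        Phi (\pi_(H2p (subvs_of V) PA) W) = \pi_(Extd PA) (unified_on AV W)) /\
     bijective Phi) /\
  (exists Psi : H2 (subvs_of V) PA -> Extd' V PA,
     (forall W : ext_structure (subvs_of V) PA,
        Psi (\pi_(H2 (subvs_of V) PA) W) = \pi_(Extd' V PA) (unified_on AV W)) /\
     bijective Psi).
Proof.
split; apply: quot_bijection => [W W'|S].
- apply: asbool_equiv_eq; split=> [[zeta [eta h]]|[phi h]].
    by exists (glue_on zeta eta); apply/over_iso_glue_on.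
  have [_ _ /(fix_glue_on AV)[zeta [eta phiE]]] := h.
  by exists zeta, eta; apply/over_iso_glue_on; rewrite -phiE.
- have [W [phi [h _]]] := unified_on_surj AV S.
  by exists W; apply/asboolP; exists phi.
- have id_bij : bijective (\1%VF : 'End(subvs_of V)).
    by exists id => x; rewrite id_lfunE.
  apply: asbool_equiv_eq; split=> [[zeta h]|[phi [h piphi]]].
    exists (glue_on zeta \1%VF); split; first exact/over_iso_glue_on.
    exact/costabilize_glue_on.
  have [_ _ /(fix_glue_on AV)[zeta [eta phiE]]] := h.
  rewrite phiE in h piphi; exists zeta.
  have /over_iso_glue_on[_] := h.
  by have /costabilize_glue_on -> := piphi.
- by have [W h] := unified_on_surj AV S; exists W; apply/asboolP.
Qed.
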